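(* Let $F_1,F_2$ be storage fee functions such that $\operatorname{dom}(F_1)=\operatorname{dom}(F_2)$. Let $\lambda_1,\lambda_2$ be the minimizers of the problems associated to $F_1,F_2$ respectively. Then $$\|\lambda_1-\lambda_2\|\le4\sqrt{C_LN\|F_1-F_2\|_\infty},$$ where $\|F_1-F_2\|_\infty$ is the supremum of $|F_1-F_2|$ over the common domain.
   Context: Setting. $N\ge1$, $n\ge2$ are integers, $X\subset\mathbb{R}^n$ is compact, $Y=\{y_1,\dots,y_N\}\subset\mathbb{R}^n$ consists of $N$ distinct points, $c:X\times Y\to\mathbb{R}$. $\mu$ is a Borel probability measure supported in $X$, absolutely continuous with respect to Lebesgue measure, with density $\rho$ that is $\alpha$-Hölder continuous, $\alpha\in(0,1]$. The cost satisfies: (Reg) $c(\cdot,y_i)\in C^2(X)$ for all $i$; (Twist) $\nabla_x c(x,y_i)\ne\nabla_x c(x,y_k)$ for all $x\in X$, $i\ne k$; (QC) for each $i$ there are a convex set $Y_i\subset\mathbb{R}^n$ and a $C^2$ diffeomorphism $\exp_i:Y_i\to X$ such that for all $t\in\mathbb{R}$ and $1\le k,i\le N$ the set $\{p\in Y_i: -c(\exp_i(p),y_k)+c(\exp_i(p),y_i)\le t\}$ is convex. $X$ is $c$-convex with respect to $Y$: $\exp_i^{-1}(X)$ is convex for every $i$. $\Lambda=\{\lambda\in\mathbb{R}^N:\sum_i\lambda^i=1,\ \lambda^i\ge0\}$; $\|\cdot\|$ is the Euclidean norm. A storage fee function is a proper closed convex function $F:\mathbb{R}^N\to\mathbb{R}\cup\{+\infty\}$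 with effective domain $\operatorname{dom}F\subset\Lambda$. For $\lambda\in\Lambda$ let $\mathcal{C}(\lambda)=\min\{\int_Xc(x,S(x))\,d\mu: S:X\to Y\text{ measurable},\ S_\#\mu=\sum_i\lambda^i\delta_{y_i}\}$ ($+\infty$ off $\Lambda$), and $\mathcal{O}_F(\lambda)=\mathcal{C}(\lambda)+F(\lambda)$. The minimizer of the problem associated to $F$ is the minimizer $\lambda$ of $\mathcal{O}_F$. $C_L>0$ is a constant, depending only on $X,Y,c,\mu$, such that $\mathcal{C}$ is strongly convex on $\Lambda$ with constant $\frac1{4C_LN}$, i.e. $\mathcal{C}-\frac{1}{8C_LN}\|\cdot\|^2$ is convex on $\Lambda$ (such a constant is known to exist). *)

(* Defs.v *)
From HB Require Import structures.
From mathcomp Require Import all_boot all_order all_algebra.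
From mathcomp Require Import all_classical all_reals all_analysis.
From mathcomp Require Import measurable_realfun.

Set Implicit Arguments.
Unset Strict Implicit.
Unset Printing Implicit Defensive.

Import Order.TTheory GRing.Theory Num.Theory.
Import numFieldNormedType.Exports.

Local Open Scope classical_set_scope.
Local Open Scope ring_scope.

(* R^n with its Borel sigma-algebra; convertible to 'rV[R]_n. *)
Definition borel_rV (R : realType) (n : nat) :=
  g_sigma_algebraType [set U : set 'rV[R]_n | open U].

Section lebesgue_rV.
Context {R : realType}.

Lemma open_measurable_rV n (U : set 'rV[R]_n) :
  open U -> measurable (U : set (borel_rV R n)).
Proof. by move=> oU; exact: sub_sigma_algebra. Qed.

Lemma measurable_coord n (j : 'I_n) :
  measurable_fun setT (fun v : borel_rV R n => v ord0 j : R).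
Proof.
apply: (measurability _ (RGenOpens.measurableE R)) => _ [_ [a [b ->]] <-].
rewrite setTI; apply: open_measurable_rV.
by apply: (open_comp (f := fun v : 'rV[R]_n => v ord0 j)) => [v _|];
  [exact: coord_continuous|exact: interval_open].
Qed.

Let rat_box n (p : 'rV[rat]_n * 'rV[rat]_n) : set 'rV[R]_n :=
  [set v | forall j, v ord0 j \in `]ratr (p.1 ord0 j), ratr (p.2 ord0 j)[].

Let open_bigcup_rat_box n (U : set 'rV[R]_n) : open U ->
  U = \bigcup_(p in [set p | rat_box p `<=` U]) rat_box p.
Proof.
move=> oU; apply/seteqP; split => [v Uv|v [p /= pU]]; last exact: pU.
have /nbhs_ballP[e /= e0 veU] : nbhs v U by exact: open_nbhs_nbhs.
have /choice[a aP] : forall j : 'I_n, exists q : rat,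
    ratr q \in `]v ord0 j - e, v ord0 j[.
  by move=> j; have /rat_in_itvoo[q] : v ord0 j - e < v ord0 j;
    [rewrite ltrBlDr ltrDl|exists q].
have /choice[b bP] : forall j : 'I_n, exists q : rat,
    ratr q \in `]v ord0 j, v ord0 j + e[.
  by move=> j; have /rat_in_itvoo[q] : v ord0 j < v ord0 j + e;
    [rewrite ltrDl|exists q].
exists (\row_j a j, \row_j b j) => /=; last first.
  by move=> j; rewrite !mxE in_itv/= (itvP (aP j)) (itvP (bP j)).
move=> w /= wab; apply: veU; split => // i j; rewrite ord1 {i}.
have := wab j; rewrite /= !mxE in_itv/= => /andP[aw wb].
rewrite /ball/= ltr_distlC; apply/andP; split.
  by apply: lt_trans aw; rewrite (itvP (aP j)).
by apply: lt_trans wb _; rewrite (itvP (bP j)).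
Qed.

Lemma measurable_rVP d (T : measurableType d) n (f : T -> borel_rV R n) :
  (forall j, measurable_fun setT (fun t => f t ord0 j : R)) ->
  measurable_fun setT f.
Proof.
move=> mf; have := @measurability _ _ T (borel_rV R n) setT f
  [set U : set 'rV[R]_n | open U] erefl; apply.

move=> _ [U oU <-]; rewrite setTI (open_bigcup_rat_box oU).
rewrite preimage_bigcup bigcup_mkcond.
apply: countable_bigcupT_measurable => [|p]; first exact: countableP.
case: ifPn => // _.
rewrite [X in measurable X](_ : _ = \bigcap_(j in [set: 'I_n])
  (setT `&` (fun t => f t ord0 j) @^-1`
    `]ratr (p.1 ord0 j), ratr (p.2 ord0 j)[%classic)); last first.
  by apply/seteqP; split => [t /= tp j _|t /= tp j];
    [split => //; exact: tp|have [] := tp j Logic.I].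
apply: fin_bigcap_measurable => // j _.
exact: mf.
Qed.

Definition rV_cons n (p : R * borel_rV R n) : borel_rV R n.+1 :=
  \row_i oapp (p.2 ord0) p.1 (unlift ord0 i).

Let rV_uncons n (v : borel_rV R n.+1) : R * borel_rV R n :=
  (v ord0 ord0, \row_j v ord0 (lift ord0 j)).

Let rV_consK n : cancel (@rV_cons n) (@rV_uncons n).
Proof.
move=> [x v]; congr (_, _); first by rewrite mxE unlift_none.
by apply/rowP => j; rewrite !mxE liftK.
Qed.

Lemma measurable_rV_cons n : measurable_fun setT (@rV_cons n).
Proof.
apply: measurable_rVP => i; case: (unliftP ord0 i) => [j ->|->].
  rewrite [X in measurable_fun _ X](_ : _ =
      fun p : R * borel_rV R n => p.2 ord0 j); last first.
    by apply/funext => p; rewrite mxE liftK.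
  exact: measurableT_comp (measurable_coord j) measurable_snd.
rewrite [X in measurable_fun _ X](_ : _ = fst)//.
by apply/funext => p; rewrite mxE unlift_none.
Qed.

Let measurable_rV_uncons n : measurable_fun setT (@rV_uncons n).
Proof.
apply: measurable_fun_pair; first exact: measurable_coord.
apply: measurable_rVP => j.
rewrite [X in measurable_fun _ X](_ : _ =
    fun v : borel_rV R n.+1 => v ord0 (lift ord0 j)); last first.
  by apply/funext => v; rewrite mxE.
exact: measurable_coord.
Qed.

Section step.
Variables (n : nat) (m : {sigma_finite_measure set (borel_rV R n) -> \bar R}).

Definition lebesgue_rV_step : set (borel_rV R n.+1) -> \bar R :=
  pushforward (@lebesgue_measure R \x m)%E (@rV_cons n).

Let preimage_rV_cons_measurable (A : set (borel_rV R n.+1)) :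
  measurable A -> measurable (@rV_cons n @^-1` A).
Proof.
by move=> mA; rewrite -[X in measurable X]setTI; exact: measurable_rV_cons.
Qed.

Let step0 : lebesgue_rV_step set0 = 0%E.
Proof. by rewrite /lebesgue_rV_step /pushforward preimage_set0 measure0. Qed.

Let step_ge0 A : (0 <= lebesgue_rV_step A)%E.
Proof. by rewrite /lebesgue_rV_step /pushforward measure_ge0. Qed.

Let step_semi_sigma_additive : semi_sigma_additive lebesgue_rV_step.
Proof.
move=> F mF tF mUF; rewrite /lebesgue_rV_step /pushforward preimage_bigcup.
apply: measure_semi_sigma_additive.
- by move=> k; exact: preimage_rV_cons_measurable.
- apply/trivIsetP => /= i j _ _ ij; rewrite -preimage_setI.
  by move/trivIsetP : tF => /(_ _ _ _ _ ij) ->//; rewrite preimage_set0.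
- by rewrite -preimage_bigcup; exact: preimage_rV_cons_measurable.
Qed.

HB.instance Definition _ := isMeasure.Build _ _ _ lebesgue_rV_step
  step0 step_ge0 step_semi_sigma_additive.

Let step_sigma_finite : sigma_finite setT lebesgue_rV_step.
Proof.
have /sigma_finiteP[F [FT ndF Foo]] := sigma_finiteT (@lebesgue_measure R).
have /sigma_finiteP[G [GT ndG Goo]] := sigma_finiteT m.
exists (fun k => @rV_uncons n @^-1` (F k `*` G k)).
  apply/esym; rewrite -subTset => v _.
  have [i _ Fi] : (\bigcup_i F i) (rV_uncons v).1 by rewrite -FT.
  have [j _ Gj] : (\bigcup_i G i) (rV_uncons v).2 by rewrite -GT.
  exists (maxn i j) => //; split.
    by move: Fi; exact/subsetPset/ndF/leq_maxl.
  by move: Gj; exact/subsetPset/ndG/leq_maxr.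
move=> k; have [mF Fk] := Foo k; have [mG Gk] := Goo k; split.
  rewrite -[X in measurable X]setTI; apply: measurable_rV_uncons => //.
  exact: measurableX.
rewrite /lebesgue_rV_step /pushforward -comp_preimage.
rewrite (_ : _ \o _ = id) ?preimage_id; last first.
  by apply/funext => p; exact: rV_consK.
by rewrite product_measure1E// lte_mul_pinfty// ge0_fin_numE.
Qed.

HB.instance Definition _ := Measure_isSigmaFinite.Build _ _ _ lebesgue_rV_step
  step_sigma_finite.

End step.

Fixpoint lebesgue_rV n : {sigma_finite_measure set (borel_rV R n) -> \bar R} :=
  match n with
  | 0 => dirac (0 : borel_rV R 0)
  | n'.+1 => lebesgue_rV_step (lebesgue_rV n')
  end.

Lemma lebesgue_rV_box n (a b : 'I_n -> R) : (forall i, a i <= b i) ->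
  lebesgue_rV n [set v | forall i, v ord0 i \in `[a i, b i]] =
  (\prod_(i < n) (b i - a i))%:E.
Proof.
elim: n a b => [|n IHn] a b ab.
  rewrite big_ord0 /= diracE (_ : _ \in _) //.
  by apply/mem_set => -[].
rewrite big_ord_recl EFinM -IHn => [|i]; last exact: ab.
have -> : (b ord0 - a ord0)%:E = @lebesgue_measure R `[a ord0, b ord0]%classic.
  rewrite lebesgue_measure_itv/= lte_fin lt_neqAle ab andbT EFinB.
  by case: eqVneq => //= ->; rewrite -EFinB subrr.
rewrite -product_measure1E//; last first.
  rewrite [X in measurable X](_ : _ = \bigcap_(j in [set: 'I_n])
    (setT `&` (fun v : borel_rV R n => v ord0 j : R) @^-1`
      `[a (lift ord0 j), b (lift ord0 j)]%classic)); last first.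
    by apply/seteqP; split => [t /= tp j _|t /= tp j];
      [split => //; exact: tp|have [] := tp j Logic.I].
  by apply: fin_bigcap_measurable => // j _; exact: measurable_coord.
congr ((_ \x _)%E _); apply/seteqP; split => [[x v]/= xv|[x v]/= [xa vb] i].
  split; first by have := xv ord0; rewrite !mxE unlift_none.
  by move=> i; have := xv (lift ord0 i); rewrite !mxE liftK.
by case: (unliftP ord0 i) => [j|] ->; rewrite !mxE ?liftK ?unlift_none//; exact: vb.
Qed.

End lebesgue_rV.

Section calculus.
Context {R : realType}.

(* The norm carried by 'rV[R]_n is the sup norm. *)
Definition enorm n (v : 'rV[R]_n) : R := Num.sqrt (\sum_i v ord0 i ^+ 2).

Definition grad n (f : 'rV[R]_n -> R) (x : 'rV[R]_n) : 'rV[R]_n :=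
  \row_i 'D_(delta_mx ord0 i) f x.

Fixpoint Ck_open (V W : normedModType R) (k : nat) (U : set V) (f : V -> W) :
    Prop :=
  match k with
  | 0 => forall x, U x -> {for x, continuous f}
  | k'.+1 => (forall x, U x -> differentiable f x) /\
             forall v, Ck_open k' U ('D_v f)
  end.

(* C^2 on an arbitrary set means C^2 on some open neighbourhood of it; the
   values of the total function f away from that set are irrelevant. *)
Definition C2_on (V W : normedModType R) (A : set V) (f : V -> W) : Prop :=
  exists U : set V, [/\ open U, A `<=` U & Ck_open 2 U f].

Definition C2_diffeo (V W : normedModType R) (A : set V) (B : set W)
    (f : V -> W) : Prop :=
  [/\ set_bij A B f, C2_on A f &
      exists2 g : W -> V, C2_on B g & forall p, A p -> g (f p) = p].

Definition hoelder_on n (A : set 'rV[R]_n) (a : R) (f : 'rV[R]_n -> R) : Prop :=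
  exists K : R, forall x z, A x -> A z -> `|f x - f z| <= K * enorm (x - z) `^ a.

End calculus.

Section convexity.
Context {R : realType} {N : nat}.
Implicit Types (D : set 'rV[R]_N) (f : 'rV[R]_N -> \bar R).
Local Open Scope ereal_scope.

(* Meant for f with values in ]-oo, +oo]: no -oo + +oo then occurs. *)
Definition econvex_on D f : Prop :=
  forall x z (t : R), D x -> D z -> (0 <= t <= 1)%R ->
    f (t *: x + (1 - t) *: z)%R <= t%:E * f x + (1 - t)%:E * f z.

Definition strongly_convex_on D (k : R) f : Prop :=
  econvex_on D (fun x => f x - (k / 2 * enorm x ^+ 2)%:E).

Definition edom f : set 'rV[R]_N := [set x | f x < +oo].

Definition proper f : Prop := (forall x, f x != -oo) /\ edom f !=set0.

Definition closed_function f : Prop :=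
  closed [set p : 'rV[R]_N * R | f p.1 <= p.2%:E].

Definition is_minimizer f (x : 'rV[R]_N) : Prop := forall z, f x <= f z.

Definition sup_dist D f g : \bar R :=
  ereal_sup [set `|f x - g x| | x in D].

End convexity.

Section semi_discrete_transport.
Context {R : realType} {n N : nat}.
Implicit Types (X : set 'rV[R]_n) (y : 'I_N -> 'rV[R]_n)
  (c : 'rV[R]_n -> 'rV[R]_n -> R) (mu : probability (borel_rV R n) R).

Definition simplex : set 'rV[R]_N :=
  [set l | \sum_i l ord0 i = 1 /\ forall i, 0 <= l ord0 i].

Definition has_density_on X mu (rho : 'rV[R]_n -> R) : Prop :=
  (forall x, X x -> 0 <= rho x) /\
  forall A : set (borel_rV R n), measurable A ->
    mu A = (\int[lebesgue_rV n]_(x in A `&` X) (rho x)%:E)%E.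

Definition regular_cost X y c : Prop := forall i, C2_on X (c ^~ (y i)).

Definition twisted_cost X y c : Prop := forall x i k, X x -> i != k ->
  grad (c ^~ (y i)) x <> grad (c ^~ (y k)) x.

(* exp_ i is a total function, of which only the restriction to P i matters. *)
Definition quasi_convex_cost X y c (P : 'I_N -> set 'rV[R]_n)
    (exp_ : 'I_N -> 'rV[R]_n -> 'rV[R]_n) : Prop :=
  forall i, [/\ convex_set (P i), C2_diffeo (P i) X (exp_ i) &
    forall (t : R) (k : 'I_N), convex_set
      [set p | P i p /\ - c (exp_ i p) (y k) + c (exp_ i p) (y i) <= t]].

Definition c_convex X (P : 'I_N -> set 'rV[R]_n)
    (exp_ : 'I_N -> 'rV[R]_n -> 'rV[R]_n) : Prop :=
  forall i, convex_set (P i `&` exp_ i @^-1` X).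

Definition transport_map (X : set (borel_rV R n)) (y : 'I_N -> borel_rV R n)
    mu (l : 'rV[R]_N) (S : borel_rV R n -> borel_rV R n) : Prop :=
  [/\ measurable_fun X S, (forall x, X x -> range y (S x)) &
      forall A : set (borel_rV R n), measurable A ->
        mu (X `&` S @^-1` A) = (\sum_i (l ord0 i)%:E * \d_(y i) A)%E].

(* The infimum over the empty set is +oo. *)
Definition transport_cost X y c mu (l : 'rV[R]_N) : \bar R :=
  if l \in simplex then
    ereal_inf [set (\int[mu]_(x in (X : set (borel_rV R n))) (c x (S x))%:E)%E |
               S in transport_map X y mu l]
  else +oo%E.

Definition storage_fee (F : 'rV[R]_N -> \bar R) : Prop :=
  [/\ proper F, closed_function F, econvex_on setT F & edom F `<=` simplex].

Definition total_cost X y c mu (F : 'rV[R]_N -> \bar R) (l : 'rV[R]_N) :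
    \bar R :=
  (transport_cost X y c mu l + F l)%E.

End semi_discrete_transport.

(* Main.v *)
(* Write C for the transport cost, k for its modulus of strong convexity and
   C + F_i for the two objectives. Comparing the minimizer l_i of C + F_i with
   the midpoint m of l_1 and l_2 gives
     k/4 |l_1 - l_2|^2 <= (C + F_i)(l_j) - (C + F_i)(l_i)   (j <> i).
   The sum over i = 1, 2 cancels C and bounds k/2 |l_1 - l_2|^2 by
   2 sup |F_1 - F_2|.
   The cancellation needs C to be finite on the simplex. It is bounded below
   because the cost is bounded on X; at a vertex it is finite because a constant
   map is admissible, and convexity extends this to the whole simplex, so
   transport maps to general weights need not be constructed. *)
Require Import Defs.
From HB Require Import structures.
From mathcomp Require Import all_boot all_order all_algebra.
From mathcomp Require Import all_classical all_reals all_analysis.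
From mathcomp Require Import ring lra.

Set Implicit Arguments.
Unset Strict Implicit.
Unset Printing Implicit Defensive.

Import Order.TTheory GRing.Theory Num.Theory.
Import numFieldNormedType.Exports.

Local Open Scope classical_set_scope.
Local Open Scope ring_scope.

(** * Integral bounds, and bounded costs on a compact set *)

(** The integral of a nonnegative function is a supremum over the simple functions below it, and
    these lie below [M] on [D]. The bound thus holds for an arbitrary [f], as is wanted for the
    integrand [c x (S x)]. *)
Lemma ge0_integral_le_cst d (T : measurableType d) (R : realType)
    (mu : {measure set T -> \bar R}) (D : set T) (f : T -> \bar R) (M : R) :
  measurable D -> (forall x, D x -> (0 <= f x <= M%:E)%E) ->
  (\int[mu]_(x in D) f x <= M%:E * mu D)%E.
Proof.
move=> mD fM; rewrite -integral_cst// !ge0_integralE//=; last 2 first.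
- by move=> x /fM /andP[f0]; exact: le_trans.
- by move=> x /fM /andP[].
apply: ereal_sup_le => _ [h /= hf <-]; exists h => //= x.
apply: le_trans (hf x) _; rewrite /patch; case: ifPn => // /set_mem /fM.
by case/andP.
Qed.

(** The integrals of the positive and negative parts both lie between 0 and [M * mu D], which is
    finite, so their difference is at most [M * mu D] in absolute value. *)
Lemma abse_integral_le_cst d (T : measurableType d) (R : realType)
    (mu : {finite_measure set T -> \bar R}) (D : set T) (f : T -> R) (M : R) :
  measurable D -> 0 <= M -> (forall x, D x -> `|f x| <= M) ->
  (`|\int[mu]_(x in D) (f x)%:E| <= M%:E * mu D)%E.
Proof.
move=> mD M0 fM; rewrite integralE.
set p := (\int[mu]_(x in D) _ x)%E; set q := (\int[mu]_(x in D) _ x)%E.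
have pM : (0 <= p <= M%:E * mu D)%E.
  rewrite integral_ge0//= ge0_integral_le_cst// => x /fM.
  rewrite funeposE ler_norml => /andP[_ fxM].
  by rewrite le_max lexx orbT/= ge_max !lee_fin fxM.
have qM : (0 <= q <= M%:E * mu D)%E.
  rewrite integral_ge0//= ge0_integral_le_cst// => x /fM.
  rewrite funenegE ler_norml => /andP[fxM _].
  by rewrite le_max lexx orbT/= ge_max !lee_fin M0 lerNl fxM.
move: p q pM qM => p q.
have -> : mu D = (fine (mu D))%:E by rewrite fineK// fin_num_measure.
case: p => [p||]; case: q => [q||] //=; rewrite ?leye_eq ?andbF//.
rewrite -EFinM !lee_fin => /andP[p0 pM] /andP[q0 qM].
by rewrite ler_norml; lra.
Qed.

Lemma compact_measurable_rV (R : realType) n (X : set 'rV[R]_n) :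
  compact X -> measurable (X : set (borel_rV R n)).
Proof.
move=> cX; rewrite -[X]setCK; apply: measurableC; apply: open_measurable_rV.
by apply: closed_openC; apply: compact_closed cX; exact: norm_hausdorff.
Qed.

Lemma C2_on_compact_bounded (R : realType) (V : normedModType R) (X : set V)
    (f : V -> R) :
  compact X -> C2_on X f -> exists M, forall x, X x -> `|f x| <= M.
Proof.
move=> cX [U [_ XU [fd _]]].
have cf : {within X, continuous f}.
  apply: continuous_in_subspaceT => x /set_mem /XU /fd.
  exact: differentiable_continuous.
have := continuous_compact cf cX => /compact_bounded.
(* Boundedness provides every real strictly above [M] as a bound; [M + 1] is one. *)
rewrite /bounded_near => -[M [_ /(_ (M + 1))]]; rewrite ltrDl ltr01 => /(_ isT) h.
by exists (M + 1) => x Xx; apply: h; exists x.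
Qed.

Lemma regular_cost_bounded (R : realType) n N (X : set 'rV[R]_n)
    (y : 'I_N -> 'rV[R]_n) c :
  compact X -> regular_cost X y c ->
  exists2 M, 0 <= M & forall i x, X x -> `|c x (y i)| <= M.
Proof.
move=> cX creg.
have /choice[M MP] i := C2_on_compact_bounded cX (creg i).
(* The sum dominates every [M i] and is nonnegative even over an empty index set. *)
exists (\sum_i `|M i|) => [|i x Xx]; first exact: sumr_ge0.
apply: le_trans (MP i x Xx) _; apply: le_trans (ler_norm _) _.
by rewrite (bigD1 i)//= lerDl sumr_ge0.
Qed.

(** * Vertices and convex combinations in the simplex *)

Section simplex.
Context {R : realType} {N : nat}.
Implicit Types l x z : 'rV[R]_N.

Lemma simplex_delta i : simplex (delta_mx ord0 i : 'rV[R]_N).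
Proof.
split=> [|j]; last by rewrite mxE ler0n.
rewrite (bigD1 i)//= mxE !eqxx big1 ?addr0// => j /negbTE ji.
by rewrite mxE ji andbF.
Qed.

(** The other coordinates are nonnegative with sum 0. In the induction below this is the case where
    renormalizing would divide by 0. *)
Lemma simplex_eq1 l i : simplex l -> l ord0 i = 1 -> l = delta_mx ord0 i.
Proof.
move=> [l1 l0] li; apply/rowP => j; rewrite mxE eqxx/=.
case: (eqVneq j i) => [->//|ji]; apply/eqP.
move: l1; rewrite (bigD1 i)//= li -[RHS]addr0 => /addrI/eqP.
by rewrite psumr_eq0// => /allP/(_ j); rewrite mem_index_enum ji => /(_ isT).
Qed.

(* Induction on the number of nonzero coordinates, splitting off one vertex. *)
Lemma simplex_ind (Q : 'rV[R]_N -> Prop) :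
  (forall i, Q (delta_mx ord0 i)) ->
  (forall x z (t : R), simplex x -> simplex z -> 0 <= t <= 1 ->
    Q x -> Q z -> Q (t *: x + (1 - t) *: z)) ->
  forall l, simplex l -> Q l.
Proof.
move=> Qd Qc l.
have [m] := ubnP #|[pred i | l ord0 i != 0]|; elim: m l => // m IHm l lm sl.
have [l1 l0] := sl.
have [i li] : exists i, l ord0 i != 0.
  apply: contrapT => /forallNP lz; move: l1; rewrite big1 => [/esym/eqP|i _].
    by rewrite oner_eq0.
  by apply/eqP/negPn/negP.
have [li1|li1] := eqVneq (l ord0 i) 1; first by rewrite (simplex_eq1 sl li1).
have lile1 : l ord0 i <= 1 by rewrite -l1 (bigD1 i)//= lerDl sumr_ge0.
have u0 : 0 < 1 - l ord0 i by rewrite subr_gt0 lt_neqAle li1.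
have un0 := lt0r_neq0 u0.
(* Coordinate [i] is deleted and the others are rescaled to total mass 1. *)
pose l' : 'rV[R]_N := \row_j (if j == i then 0 else l ord0 j / (1 - l ord0 i)).
have -> : l = l ord0 i *: delta_mx ord0 i + (1 - l ord0 i) *: l'.
  apply/rowP => j; rewrite !mxE eqxx/=; case: (eqVneq j i) => [->|_].
    by rewrite mulr1 mulr0 addr0.
  by rewrite mulr0 add0r mulrC divfK.
have sl' : simplex l'.
  split=> [|j]; last by rewrite mxE; case: ifP => // _; rewrite divr_ge0// ltW.
  rewrite (bigD1 i)//= mxE eqxx add0r.
  under eq_bigr => j /negbTE ji do rewrite mxE ji.
  rewrite -mulr_suml (_ : \sum_(j | j != i) _ = 1 - l ord0 i) ?divff//.
  by rewrite -l1 [in RHS](bigD1 i)//= [RHS]addrC addKr.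
apply: Qc => //; first exact: simplex_delta.
  by rewrite l0 lile1.
(* The support of [l'] lies in that of [l] and has lost [i]. *)
apply: IHm => //; rewrite ltnS in lm; apply: leq_trans lm; apply: proper_card; apply/properP; split.
  apply/fintype.subsetP => j; rewrite !inE mxE; case: ifP => [_|_]; first by rewrite eqxx.
  by apply: contraNN => /eqP ->; rewrite mul0r.
by exists i; rewrite !inE ?mxE ?eqxx.
Qed.

End simplex.

(** * The Euclidean norm *)

Section enorm.
Context {R : realType} {N : nat}.
Implicit Types x z : 'rV[R]_N.

Lemma sqr_enorm x : enorm x ^+ 2 = \sum_i x ord0 i ^+ 2.
Proof. by rewrite sqr_sqrtr// sumr_ge0// => i _; rewrite sqr_ge0. Qed.

Lemma enorm_ge0 x : 0 <= enorm x.
Proof. exact: sqrtr_ge0. Qed.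

(** A polynomial identity in each coordinate. Its last term is the gain of strong convexity over
    convexity. *)
Lemma sqr_enorm_convex x z (t : R) :
  enorm (t *: x + (1 - t) *: z) ^+ 2 =
  t * enorm x ^+ 2 + (1 - t) * enorm z ^+ 2 - t * (1 - t) * enorm (x - z) ^+ 2.
Proof.
rewrite !sqr_enorm !mulr_sumr -big_split -sumrB /=.
by apply: eq_bigr => i _; rewrite !mxE; ring.
Qed.

Lemma enormBC x z : enorm (x - z) = enorm (z - x).
Proof. by rewrite /enorm; congr Num.sqrt; apply: eq_bigr => i _; rewrite !mxE; ring. Qed.

End enorm.

(** * Growth of an objective at its minimizer, and stability of minimizers *)

Section minimizers.
Context {R : realType} {N : nat}.
Implicit Types (D : set 'rV[R]_N) (C F : 'rV[R]_N -> \bar R).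

(** At the midpoint strong convexity gains [k / 8] times the squared distance; the average of the
    end values doubles this to [k / 4]. *)
Lemma minimizer_growth D (k : R) C F (l z : 'rV[R]_N) :
  (forall x, C x != -oo%E) -> strongly_convex_on D k C ->
  (forall x, F x != -oo%E) -> econvex_on setT F ->
  is_minimizer (fun x => C x + F x)%E l -> D l -> D z ->
  C l \is a fin_num -> F l \is a fin_num ->
  C z \is a fin_num -> F z \is a fin_num ->
  k / 4 * enorm (l - z) ^+ 2 <=
    (fine (C z) + fine (F z)) - (fine (C l) + fine (F l)).
Proof.
move=> CNy Csc FNy Fc lmin Dl Dz fCl fFl fCz fFz.
have t01 : 0 <= (2^-1 : R) <= 1 by lra.
have := Csc l z 2^-1 Dl Dz t01; have := Fc l z 2^-1 Logic.I Logic.I t01.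
have := lmin (2^-1 *: l + (1 - 2^-1) *: z); have := sqr_enorm_convex l z 2^-1.
move: (2^-1 *: l + (1 - 2^-1) *: z) => m.
have := CNy m; have := FNy m.
rewrite -(fineK fCl) -(fineK fFl) -(fineK fCz) -(fineK fFz) /=.
(* At the midpoint [m], convexity with finite end values excludes +oo. *)
case: (C m) => [Cm||]//; case: (F m) => [Fm||]//= _ _ nm.
rewrite -!(EFinB, EFinD, EFinM) !lee_fin nm; lra.
Qed.

(** The minimal value is at most the one at [z], hence below +oo; as neither summand is -oo, both
    are finite. *)
Lemma is_minimizer_fin_num C F (l z : 'rV[R]_N) :
  (forall x, C x != -oo%E) -> (forall x, F x != -oo%E) ->
  is_minimizer (fun x => C x + F x)%E l -> (C z < +oo)%E -> (F z < +oo)%E ->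
  C l \is a fin_num /\ F l \is a fin_num.
Proof.
move=> CNy FNy /(_ z) + Cz Fz; have := CNy l; have := FNy l.
have := lte_add_pinfty Cz Fz.
by case: (C l) => [?||]//; case: (F l) => [?||]//= + _ _;
  rewrite ?leye_eq => /[swap] /eqP ->.
Qed.

Lemma minimizer_dist D (k : R) C F1 F2 (l1 l2 : 'rV[R]_N) :
  0 < k -> (forall x, C x != -oo%E) -> (forall x, D x -> (C x < +oo)%E) ->
  strongly_convex_on D k C ->
  Defs.proper F1 -> Defs.proper F2 -> econvex_on setT F1 -> econvex_on setT F2 ->
  edom F1 `<=` D -> edom F1 = edom F2 ->
  is_minimizer (fun x => C x + F1 x)%E l1 ->
  is_minimizer (fun x => C x + F2 x)%E l2 ->
  ((enorm (l1 - l2))%:E <= 2%:E * sqrte (k^-1%:E * sup_dist (edom F1) F1 F2))%E.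
Proof.
move=> k0 CNy Cfin Csc [F1Ny [z1 F1z1]] [F2Ny [z2 F2z2]] F1c F2c F1D domE m1 m2.
have F2D : edom F2 `<=` D by rewrite -domE.
have [fC1 fF1] := is_minimizer_fin_num CNy F1Ny m1 (Cfin _ (F1D _ F1z1)) F1z1.
have [fC2 fF2] := is_minimizer_fin_num CNy F2Ny m2 (Cfin _ (F2D _ F2z2)) F2z2.
have d11 : edom F1 l1 by rewrite /edom/= ltey_eq fF1.
have d22 : edom F2 l2 by rewrite /edom/= ltey_eq fF2.
(* Equality of the domains makes each fee finite at the minimizer of the other problem. *)
have d12 : edom F1 l2 by rewrite domE.
have d21 : edom F2 l1 by rewrite -domE.
have fF12 : F1 l2 \is a fin_num by rewrite fin_real// ltNye F1Ny.
have fF21 : F2 l1 \is a fin_num by rewrite fin_real// ltNye F2Ny.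
have := minimizer_growth CNy Csc F1Ny F1c m1 (F1D _ d11) (F1D _ d12) fC1 fF1 fC2 fF12.
have := minimizer_growth CNy Csc F2Ny F2c m2 (F2D _ d22) (F2D _ d21) fC2 fF2 fC1 fF21.
rewrite [enorm (l2 - l1)]enormBC.
have sup1 : (`|F1 l1 - F2 l1| <= sup_dist (edom F1) F1 F2)%E.
  by apply: ereal_sup_ubound; exists l1.
have sup2 : (`|F1 l2 - F2 l2| <= sup_dist (edom F1) F1 F2)%E.
  by apply: ereal_sup_ubound; exists l2.
rewrite -(fineK fF1) -(fineK fF21) in sup1; rewrite -(fineK fF12) -(fineK fF2) in sup2.
move: sup1 sup2.
(* If the supremum is +oo, so is the right-hand side; -oo is excluded by the absolute values below
   it. *)
case: sup_dist => [e||]; last 2 first.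
- by move=> _ _ _ _; rewrite gt0_muley ?lte_fin ?invr_gt0//= gt0_muley ?leey ?lte_fin.
- by [].
rewrite /= !lee_fin !ler_norml => /andP[a1 a2] /andP[b1 b2] g2 g1.
have e0 : 0 <= e by lra.
(* Adding [g1] and [g2] leaves two differences of fees, each at most [e] in absolute value. The
   constant is written [2 ^+ 2] to leave the root as 2. *)
have kd : enorm (l1 - l2) ^+ 2 <= 2 ^+ 2 * (k^-1 * e).
  by rewrite mulrCA ler_pdivlMl//; lra.
rewrite -[enorm _]ger0_norm ?enorm_ge0// -sqrtr_sqr.
apply: le_trans (ler_wsqrtr kd) _.
by rewrite sqrtrM ?sqrtr_sqr ?ger0_norm// sqr_ge0.
Qed.

End minimizers.

(** * Finiteness of the transport cost *)

Section transport_cost.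
Context {R : realType} {n N : nat}.
Variables (X : set 'rV[R]_n) (y : 'I_N -> 'rV[R]_n).
Variables (c : 'rV[R]_n -> 'rV[R]_n -> R) (mu : probability (borel_rV R n) R).
Hypotheses (cptX : compact X) (mu_supp : mu (~` X) = 0%E).
Hypothesis c_reg : regular_cost X y c.

Let mX : measurable (X : set (borel_rV R n)).
Proof. exact: compact_measurable_rV. Qed.

Let muX : mu (X : set (borel_rV R n)) = 1%E.
Proof.
have := mu_supp; have muS := @probability_setC _ _ _ mu _ mX.
by rewrite [mu _]muS => /eqP; rewrite sube_eq ?add0e// => /eqP <-.
Qed.

(** On [X] a transport map takes values among the [y i], so one bound of the cost serves all weights
    and maps; a uniform bound passes to the infimum. *)
Lemma transport_map_cost_bounded :
  exists M : R, forall l S, transport_map X y mu l S ->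
    (`|\int[mu]_(x in (X : set (borel_rV R n))) (c x (S x))%:E| <= M%:E)%E.
Proof.
have [M M0 cM] := regular_cost_bounded cptX c_reg.
exists M => l S [_ Sy _]; rewrite -[leRHS]mule1 -muX.
by apply: abse_integral_le_cst => // x Xx; have [i _ <-] := Sy x Xx; exact: cM.
Qed.

Lemma transport_cost_neqNy l : transport_cost X y c mu l != -oo%E.
Proof.
rewrite /transport_cost; case: ifP => // _.
have [M MP] := transport_map_cost_bounded.
rewrite -ltNye (@lt_le_trans _ _ (- M)%:E) ?ltNyr//.
apply: le_ereal_inf_tmp => _ [S /MP] + <-.
by case: (\int[mu]_(x in _) _)%E => [r||]//=; rewrite !lee_fin ler_norml => /andP[].
Qed.

Lemma transport_map_cst i :
  transport_map X y mu (delta_mx ord0 i) (cst (y i)).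
Proof.
split=> [|x _|A mA]; [exact: measurable_cst|by exists i|].
rewrite (bigD1 i)//= big1 ?adde0 => [|j /negbTE ji]; last first.
  by rewrite mxE ji andbF mul0e.
rewrite mxE !eqxx mul1e preimage_cst diracE.
(* The preimage of [A] is everything or empty, according to whether [y i] lies in [A]. *)
by case: ifPn => _; rewrite ?setIT ?setI0 ?measure0.
Qed.

Lemma transport_cost_delta_ltey i :
  (transport_cost X y c mu (delta_mx ord0 i) < +oo)%E.
Proof.
rewrite /transport_cost mem_set; last exact: simplex_delta.
have [M MP] := transport_map_cost_bounded.
apply: (@le_lt_trans _ _ M%:E); last exact: ltry.
apply: le_trans (le_trans (lee_abs _) (MP _ _ (transport_map_cst i))).
by apply: ereal_inf_lbound; exists (cst (y i)) => //; exact: transport_map_cst.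
Qed.

Lemma transport_cost_ltey (k : R) l :
  strongly_convex_on simplex k (transport_cost X y c mu) ->
  simplex l -> (transport_cost X y c mu l < +oo)%E.
Proof.
move=> sc; move: l; apply: simplex_ind; first exact: transport_cost_delta_ltey.
move=> x z t sx sz t01; have := sc x z t sx sz t01.
have := transport_cost_neqNy x; have := transport_cost_neqNy z.
case: (transport_cost X y c mu x) => [a||]//.
case: (transport_cost X y c mu z) => [b||]//= _ _.
(* A value +oo at the combination would contradict the convexity inequality, whose right-hand side
   is real. *)
by case: (transport_cost _ _ _ _ _) => [d||]// _ _ _; rewrite ltry.
Qed.

End transport_cost.

Theorem proposition6p2 (R : realType) (n N : nat) (hn : (2 <= n)%N)
    (hN : (1 <= N)%N)
    (X : set 'rV[R]_n) (cptX : compact X)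
    (y : 'I_N -> 'rV[R]_n) (injy : injective y)
    (c : 'rV[R]_n -> 'rV[R]_n -> R)
    (mu : probability (borel_rV R n) R) (mu_supp : mu (~` X) = 0%E)
    (rho : 'rV[R]_n -> R) (mu_density : has_density_on X mu rho)
    (a : R) (a01 : 0 < a <= 1) (rho_hoelder : hoelder_on X a rho)
    (c_reg : regular_cost X y c) (c_twist : twisted_cost X y c)
    (P : 'I_N -> set 'rV[R]_n) (exp_ : 'I_N -> 'rV[R]_n -> 'rV[R]_n)
    (c_qc : quasi_convex_cost X y c P exp_) (X_convex : c_convex X P exp_)
    (CL : R) (CL_gt0 : 0 < CL)
    (C_strongly_convex :
      strongly_convex_on simplex (4 * CL * N%:R)^-1 (transport_cost X y c mu))
    (F1 F2 : 'rV[R]_N -> \bar R)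
    (F1_fee : storage_fee F1) (F2_fee : storage_fee F2)
    (dom_eq : edom F1 = edom F2)
    (l1 l2 : 'rV[R]_N)
    (l1_min : is_minimizer (total_cost X y c mu F1) l1)
    (l2_min : is_minimizer (total_cost X y c mu F2) l2) :
  ((enorm (l1 - l2))%:E <=
     4%:E * sqrte ((CL * N%:R)%:E * sup_dist (edom F1) F1 F2))%E.
Proof.
have [F1p _ F1c F1s] := F1_fee; have [F2p _ F2c _] := F2_fee.
have N0 : 0 < N%:R :> R by rewrite ltr0n.
have k0 : 0 < (4 * CL * N%:R)^-1 by rewrite invr_gt0 !mulr_gt0.
have := minimizer_dist k0 (transport_cost_neqNy cptX mu_supp c_reg)
  (fun x => transport_cost_ltey cptX mu_supp c_reg C_strongly_convex)
  C_strongly_convex F1p F2p F1c F2c F1s dom_eq l1_min l2_min.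
(* The inverse modulus is [4 * CL * N%:R]; its factor 4 leaves the root as 2, and 2 * 2 is the
   stated constant. *)
rewrite invrK -mulrA EFinM -muleA sqrteM ?lee_fin// muleA.
have -> : sqrte 4%:E = 2%:E :> \bar R.
  by rewrite (_ : 4 = 2 ^+ 2) ?EFin_expe ?sqrte_sqr -?natrX//= ger0_norm.
by rewrite -EFinM -natrM.
Qed.
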